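(* Let $\alpha,\beta,\gamma\in\mathbb{R}$ with $\gamma\neq0$, and let $G_2$ be the connected, simply connected three-dimensional Lie group with left-invariant Lorentzian metric $g$ whose Lie algebra has a pseudo-orthonormal basis $\{\widetilde e_1,\widetilde e_2,\widetilde e_3\}$, with $\widetilde e_3$ timelike, satisfying $$[\widetilde e_1,\widetilde e_2]=\gamma\widetilde e_2-\beta\widetilde e_3,\quad [\widetilde e_1,\widetilde e_3]=-\beta\widetilde e_2-\gamma\widetilde e_3,\quad [\widetilde e_2,\widetilde e_3]=\alpha\widetilde e_1.$$ Then the symmetrized Ricci tensor $\widetilde\rho^k$ of the Kobayashi-Nomizu connection $\nabla^k$ is a Codazzi tensor on $(G_2,\nabla^k)$ if and only if $\gamma\neq0$ and $\alpha=\beta=0$.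
   Context: Basis vectors are identified with left-invariant vector fields on the group $G$; $g(\widetilde e_1,\widetilde e_1)=g(\widetilde e_2,\widetilde e_2)=1$, $g(\widetilde e_3,\widetilde e_3)=-1$, and $g(\widetilde e_i,\widetilde e_j)=0$ for $i\ne j$. Let $\nabla^L$ be the Levi-Civita connection of $g$ and $J$ the product structure on $G$ (a $(1,1)$ tensor field) with $J\widetilde e_1=\widetilde e_1$, $J\widetilde e_2=\widetilde e_2$, $J\widetilde e_3=-\widetilde e_3$. Put $(\nabla^L_XJ)Y=\nabla^L_X(JY)-J\nabla^L_XY$. The canonical connection is $\nabla^c_XY=\nabla^L_XY-\tfrac12(\nabla^L_XJ)JY$, and the Kobayashi-Nomizu connection is $\nabla^k_XY=\nabla^c_XY-\tfrac14[(\nabla^L_YJ)JX-(\nabla^L_{JY}J)X]$. Curvature: $R^k(X,Y)Z=\nabla^k_X\nabla^k_YZ-\nabla^k_Y\nabla^k_XZ-\nabla^k_{[X,Y]}Z$. Ricci tensor: $\rho^k(X,Y)=-g(R^k(X,\widetilde e_1)Y,\widetilde e_1)-g(R^k(X,\widetilde e_2)Y,\widetilde e_2)+g(R^k(X,\widetilde e_3)Y,\widetilde e_3)$. Symmetrized Ricci tensor: $\widetilde\rho^k(X,Y)=\tfrac12(\rho^k(X,Y)+\rho^k(Y,X))$. For a linear connection $\nabla$ and a $(0,2)$ tensor field $\omega$: $(\nabla_X\omega)(Y,Z)=X[\omega(Y,Z)]-\omega(\nabla_XY,Z)-\omega(Y,\nabla_XZ)$. The tensor $\omega$ is called a Codazzi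 tensor on $(G,\nabla)$ if $(\nabla_X\omega)(Y,Z)-(\nabla_Y\omega)(X,Z)=0$ for all vector fields $X,Y,Z$. *)

(* Defs.v *)
From HB Require Import structures.
From mathcomp Require Import all_boot all_order all_algebra.
From mathcomp Require Import all_classical all_reals all_analysis.

Set Implicit Arguments.
Unset Strict Implicit.
Unset Printing Implicit Defensive.

Import Order.TTheory GRing.Theory Num.Theory.
Import numFieldNormedType.Exports.

Local Open Scope classical_set_scope.
Local Open Scope ring_scope.

Section Smooth.
Context {R : realType} {V W : normedModType R}.

(* For V finite-dimensional and U open this is the usual class C^k on U. *)
Fixpoint diff_class (k : nat) (U : set V) (f : V -> W) : Prop :=
  if k is k'.+1 then
    (forall x, U x -> differentiable f x) /\
    (forall v, diff_class k' U (fun x => 'D_v f x))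
  else forall x, U x -> {for x, continuous f}.

Definition smooth_on (U : set V) (f : V -> W) := forall k, diff_class k U f.

Lemma differentiable_near (f g : V -> W) (x : V) :
  (\forall y \near x, f y = g y) -> differentiable f x ->
  differentiable g x /\ forall v, 'D_v g x = 'D_v f x.
Proof.
move=> fg df.
pose h := g - f.
have h0 : h x = 0 by rewrite /h !fctE -(nbhs_singleton fg) subrr.
pose z : {linear V -> W} := \0.
have hE : h \o shift x = cst (h x) + z +o_ 0 id.
  apply/eqaddoP => _/posnumP[eps].
  have : \forall y \near (0 : V), f (y + x) = g (y + x).
    by have := fg; rewrite {1}(near_shift 0) /= subr0.
  apply: filterS => y /= fgy.
  rewrite !fctE /= h0 /h !fctE /= fgy subrr !addr0 subr0 normr0.
  by rewrite mulr_ge0// ltW.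
have c0 : continuous z by move=> y; exact: cst_continuous.
have dh := diff_unique c0 hE.
have hd : differentiable h x by apply/diff_locallyP; rewrite dh; split.
have gE : g = f + h by rewrite /h addrC subrK.
have dg : differentiable g x by rewrite gE; apply: differentiableD.
split=> // v; rewrite gE deriveD; [|exact: diff_derivable..].
by rewrite [X in _ + X]deriveE// dh addr0.
Qed.

Lemma diff_class_eq k (U : set V) (f g : V -> W) : open U ->
  (forall x, U x -> f x = g x) -> diff_class k U f -> diff_class k U g.
Proof.
move=> oU; elim: k f g => [|k IH] f g fg /=.
  move=> cf x Ux.
  have nfg : (\forall y \near x, f y = g y).
    by near=> y; apply: fg; near: y; exact: open_nbhs_nbhs.
  have := cf x Ux; rewrite /prop_for /continuous_at (fg _ Ux) => H.
  by apply: cvg_trans H; exact: near_eq_cvg.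
move=> [df Df].
have nfg x : U x -> (\forall y \near x, f y = g y).
  by move=> Ux; near=> y; apply: fg; near: y; exact: open_nbhs_nbhs.
split=> [x Ux|v]; first exact: (differentiable_near (nfg x Ux) (df x Ux)).1.
apply: IH (Df v) => x Ux.
by rewrite (differentiable_near (nfg x Ux) (df x Ux)).2.
Unshelve. all: by end_near. Qed.

Lemma diff_classS k (U : set V) (f : V -> W) :
  diff_class k.+1 U f -> diff_class k U f.
Proof.
elim: k f => [|k IH] f [df Df].
  by move=> x Ux; apply: differentiable_continuous; exact: df.
by split=> // v; apply: IH; exact: Df.
Qed.

Lemma diff_class_cst k (U : set V) (a : W) : diff_class k U (cst a).
Proof.
elim: k a => [|k IH] a /=; first by move=> x _; exact: cst_continuous.
split=> [x _|v]; first exact: differentiable_cst.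
rewrite (_ : (fun x => _) = cst 0) //.
by apply/funext => x; rewrite derive_cst.
Qed.

Lemma diff_classD k (U : set V) (f g : V -> W) : open U ->
  diff_class k U f -> diff_class k U g -> diff_class k U (f + g).
Proof.
move=> oU; elim: k f g => [|k IH] f g.
  by move=> cf cg x Ux; apply: continuousD; [exact: cf|exact: cg].
move=> [df Df] [dg Dg]; split=> [x Ux|v].
  by apply: differentiableD; [exact: df|exact: dg].
apply: (diff_class_eq (f := (fun x => 'D_v f x) + (fun x => 'D_v g x))) => //.
  by move=> x Ux; rewrite deriveD//; apply: diff_derivable; [exact: df|exact: dg].
by apply: IH; [exact: Df|exact: Dg].
Qed.

End Smooth.

Lemma diff_classM (R : realType) (V : normedModType R) k (U : set V)
    (f g : V -> R) : open U ->
  diff_class k U f -> diff_class k U g -> diff_class k U (f * g).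
Proof.
move=> oU; elim: k f g => [|k IH] f g.
  by move=> cf cg x Ux; exact: cvgM (cf x Ux) (cg x Ux).
move=> Cf Cg; have [df Df] := Cf; have [dg Dg] := Cg; split=> [x Ux|v].
  by apply: differentiableM; [exact: df|exact: dg].
apply: (diff_class_eq
  (f := f * (fun x => 'D_v g x) + g * (fun x => 'D_v f x))) => //.
  move=> x Ux; have dfx : derivable f x v by apply: diff_derivable; exact: df.
  have dgx : derivable g x v by apply: diff_derivable; exact: dg.
  by rewrite (deriveM dfx dgx).
apply: diff_classD => //; apply: IH.
- exact: diff_classS Cf.
- exact: Dg.
- exact: diff_classS Cg.
- exact: Df.
Qed.

(* The two maps are total functions, constrained only on the domain and the
   codomain of the chart. *)
Record chart (M E : topologicalType) := Chart {
  chart_dom : set M;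
  chart_cod : set E;
  chart_map : M -> E;
  chart_inv : E -> M;
  chart_open_dom : open chart_dom;
  chart_open_cod : open chart_cod;
  chart_mapS : forall p, chart_dom p -> chart_cod (chart_map p);
  chart_invS : forall x, chart_cod x -> chart_dom (chart_inv x);
  chart_mapK : forall p, chart_dom p -> chart_inv (chart_map p) = p;
  chart_invK : forall x, chart_cod x -> chart_map (chart_inv x) = x;
  chart_map_continuous :
    forall p, chart_dom p -> {for p, continuous chart_map};
  chart_inv_continuous :
    forall x, chart_cod x -> {for x, continuous chart_inv}
}.

HB.mixin Record isManifold (R : realType) (n : nat) M of Topological M := {
  atlas : set (chart M 'rV[R]_n);
  atlas_cover : forall p : M, exists2 c, atlas c & chart_dom c p;
  atlas_smooth : forall c d, atlas c -> atlas d ->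
    smooth_on [set x | chart_cod c x /\ chart_dom d (chart_inv c x)]
      (fun x => chart_map d (chart_inv c x));
  manifold_hausdorff : hausdorff_space M;
  manifold_second_countable : @second_countable M
}.

#[short(type="manifoldType")]
HB.structure Definition Manifold (R : realType) (n : nat) :=
  {M of isManifold R n M & Topological M}.

Arguments atlas {R n} M : rename.

HB.mixin Record isLieGroup (R : realType) (n : nat) G
    of Manifold R n G & Group G := {
  lie_mul_continuous : continuous (fun p : G * G => (p.1 * p.2)%g);
  lie_inv_continuous : continuous (fun p : G => p^-1%g);
  lie_mul_smooth : forall c d e : chart G 'rV[R]_n,
    atlas G c -> atlas G d -> atlas G e ->
    smooth_on [set z : 'rV[R]_n * 'rV[R]_n |
        [/\ chart_cod c z.1, chart_cod d z.2 &
            chart_dom e (chart_inv c z.1 * chart_inv d z.2)%g]]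
      (fun z => chart_map e (chart_inv c z.1 * chart_inv d z.2)%g);
  lie_inv_smooth : forall c d : chart G 'rV[R]_n, atlas G c -> atlas G d ->
    smooth_on [set x | chart_cod c x /\ chart_dom d (chart_inv c x)^-1%g]
      (fun x => chart_map d (chart_inv c x)^-1%g)
}.

#[short(type="lieGroupType")]
HB.structure Definition LieGroup (R : realType) (n : nat) :=
  {G of isLieGroup R n G & Manifold R n G & Group G}.

Definition simply_connected (R : realType) (T : topologicalType) : Prop :=
  (forall x y : T, exists w : R -> T,
     [/\ {within `[0, 1], continuous w}, w 0 = x & w 1 = y]) /\
  (forall w : R -> T, {within `[0, 1], continuous w} -> w 0 = w 1 ->
     exists H : R * R -> T,
       [/\ {within `[0, 1] `*` `[0, 1], continuous H},
           forall t, t \in `[0, 1] -> H (0, t) = w t,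
           forall t, t \in `[0, 1] -> H (1, t) = w 0 &
           forall s, s \in `[0, 1] -> H (s, 0) = w 0 /\ H (s, 1) = w 0]).

Section SmoothFunctions.
Context (R : realType) (n : nat) (M : manifoldType R n).

Definition smooth_funs : set (M -> R) :=
  [set f | forall c, atlas M c ->
     smooth_on (chart_cod c) (fun x => f (chart_inv c x))].

Record Cinf := MkCinf { Cinf_fun :> M -> R; _ : Cinf_fun \in smooth_funs }.

HB.instance Definition _ := [isSub for Cinf_fun].
HB.instance Definition _ := [Choice of Cinf by <:].

Lemma smooth_funs_cst (a : R) : smooth_funs (cst a).
Proof. by move=> c ac k; exact: diff_class_cst. Qed.

Lemma smooth_funsM f g : smooth_funs f -> smooth_funs g -> smooth_funs (f * g).
Proof.
move=> sf sg c ac k.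
by apply: diff_classM; [exact: chart_open_cod|exact: sf|exact: sg].
Qed.

Lemma smooth_funs_subring : subring_closed (mem smooth_funs).
Proof.
split=> [|f g|f g]; rewrite !inE; first exact: smooth_funs_cst.
  move=> sf sg; have -> : f - g = f + cst (-1) * g.
    by apply/funext => p; rewrite !fctE mulN1r.
  have sg' := smooth_funsM (smooth_funs_cst (-1)) sg => c ac k.
  by apply: diff_classD; [exact: chart_open_cod|exact: sf|exact: sg'].
exact: smooth_funsM.
Qed.

HB.instance Definition _ :=
  GRing.SubChoice_isSubComPzRing.Build _ _ Cinf smooth_funs_subring.

Lemma smooth_funs_scaler : GRing.scaler_closed (mem smooth_funs).
Proof.
move=> a f; rewrite !inE => sf.
exact: smooth_funsM (smooth_funs_cst a) sf.
Qed.

Lemma smooth_funs_subsemimod : GRing.subsemimod_closed (mem smooth_funs).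
Proof.
split; last exact: smooth_funs_scaler.
exact: GRing.zmod_closedD (GRing.subring_closedB smooth_funs_subring).
Qed.

HB.instance Definition _ := GRing.SubZmodule_isSubLmodule.Build
  R (M -> R) _ Cinf smooth_funs_subsemimod.

End SmoothFunctions.

Arguments Cinf {R n} M.

Section Fields.
Context {R : realType} {n : nat} {M : manifoldType R n}.

(* Vector fields are among the operators on smooth functions, which form an
   R-vector space under the pointwise operations. *)
Definition operator := Cinf M -> Cinf M.

Implicit Types (f : Cinf M) (X Y Z : operator).

(* In each chart of the atlas, X = \sum_i a^i d/dx^i with smooth a^i. *)
Definition vector_field X : Prop :=
  forall c, atlas M c ->
    exists2 a : 'rV[R]_n -> 'rV[R]_n, smooth_on (chart_cod c) a &
      forall f x, chart_cod c x ->
        X f (chart_inv c x) = 'D_(a x) (fun y => f (chart_inv c y)) x.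

Definition fscale f X : operator := fun h => f * X h.

Definition lie_bracket X Y : operator := fun f => X (Y f) - Y (X f).

(* (0,2) and (1,1) tensor fields, as C^oo-multilinear maps on vector fields. *)
Definition tensor02 (w : operator -> operator -> Cinf M) : Prop :=
  forall f X Y Z, vector_field X -> vector_field Y -> vector_field Z ->
    w (fscale f X + Y) Z = f * w X Z + w Y Z /\
    w Z (fscale f X + Y) = f * w Z X + w Z Y.

Definition tensor11 (A : operator -> operator) : Prop :=
  (forall X, vector_field X -> vector_field (A X)) /\
  (forall f X Y, vector_field X -> vector_field Y ->
     A (fscale f X + Y) = fscale f (A X) + A Y).

Definition product_structure (J : operator -> operator) : Prop :=
  tensor11 J /\ (forall X, vector_field X -> J (J X) = X).

(* Lorentzian metric of signature (+, ..., +, -); the tangent spaces have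
   dimension n, so the last clause includes nondegeneracy. *)
Definition lorentzian_metric (g : operator -> operator -> Cinf M) : Prop :=
  [/\ tensor02 g,
      forall X Y, vector_field X -> vector_field Y -> g X Y = g Y X &
      forall p : M, exists2 E : 'I_n -> operator,
        (forall i, vector_field (E i)) &
        forall i j, g (E i) (E j) p =
          if i == j then (if i.+1 == n then -1 else 1) else 0].

Definition linear_connection (nab : operator -> operator -> operator) : Prop :=
  [/\ forall X Y, vector_field X -> vector_field Y -> vector_field (nab X Y),
      forall f X Y Z, vector_field X -> vector_field Y -> vector_field Z ->
        nab (fscale f X + Y) Z = fscale f (nab X Z) + nab Y Z,
      forall X Y Z, vector_field X -> vector_field Y -> vector_field Z ->
        nab X (Y + Z) = nab X Y + nab X Z &
      forall f X Y, vector_field X -> vector_field Y ->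
        nab X (fscale f Y) = fscale (X f) Y + fscale f (nab X Y)].

(* (nab_X w)(Y, Z) *)
Definition cov_deriv02 (nab : operator -> operator -> operator)
    (w : operator -> operator -> Cinf M) X Y Z : Cinf M :=
  X (w Y Z) - w (nab X Y) Z - w Y (nab X Z).

(* (nab_X A) Y *)
Definition cov_deriv11 (nab : operator -> operator -> operator)
    (A : operator -> operator) X Y : operator :=
  nab X (A Y) - A (nab X Y).

Definition levi_civita (g : operator -> operator -> Cinf M)
    (nab : operator -> operator -> operator) : Prop :=
  [/\ linear_connection nab,
      forall X Y, vector_field X -> vector_field Y ->
        nab X Y - nab Y X = lie_bracket X Y &
      forall X Y Z, vector_field X -> vector_field Y -> vector_field Z ->
        cov_deriv02 nab g X Y Z = 0].

Definition canonical_connection (nabL : operator -> operator -> operator)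
    (J : operator -> operator) X Y : operator :=
  nabL X Y - 2^-1 *: cov_deriv11 nabL J X (J Y).

Definition kobayashi_nomizu (nabL : operator -> operator -> operator)
    (J : operator -> operator) X Y : operator :=
  canonical_connection nabL J X Y -
  4^-1 *: (cov_deriv11 nabL J Y (J X) - cov_deriv11 nabL J (J Y) X).

Definition curvature (nab : operator -> operator -> operator) X Y Z : operator :=
  nab X (nab Y Z) - nab Y (nab X Z) - nab (lie_bracket X Y) Z.

(* Ricci tensor with respect to a pseudo-orthonormal frame whose last vector is
   timelike. *)
Definition ricci (g : operator -> operator -> Cinf M)
    (nab : operator -> operator -> operator) (e1 e2 e3 : operator) X Y : Cinf M :=
  - g (curvature nab X e1 Y) e1 - g (curvature nab X e2 Y) e2
  + g (curvature nab X e3 Y) e3.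

Definition sym_ricci (g : operator -> operator -> Cinf M)
    (nab : operator -> operator -> operator) (e1 e2 e3 : operator) X Y : Cinf M :=
  2^-1 *: (ricci g nab e1 e2 e3 X Y + ricci g nab e1 e2 e3 Y X).

Definition codazzi (nab : operator -> operator -> operator)
    (w : operator -> operator -> Cinf M) : Prop :=
  forall X Y Z, vector_field X -> vector_field Y -> vector_field Z ->
    cov_deriv02 nab w X Y Z - cov_deriv02 nab w Y X Z = 0.

End Fields.

Arguments operator {R n} M.

Section LeftInvariant.
Context {R : realType} {n : nat} {G : lieGroupType R n}.
Implicit Types (X Y : operator G).

(* X (f o L_a) = (X f) o L_a, where h stands for the smooth function f o L_a. *)
Definition left_invariant X : Prop :=
  vector_field X /\
  forall (a : G) (f h : Cinf G), (forall p, h p = f (a * p)%g) ->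
    forall p, X h p = X f (a * p)%g.

Definition lie_algebra_basis3 (e1 e2 e3 : operator G) : Prop :=
  [/\ left_invariant e1, left_invariant e2, left_invariant e3 &
      forall X, left_invariant X ->
        exists! a : R * R * R, X = a.1.1 *: e1 + a.1.2 *: e2 + a.2 *: e3].

Definition left_invariant_metric
    (g : operator G -> operator G -> Cinf G) : Prop :=
  forall X Y, left_invariant X -> left_invariant Y ->
    forall p q : G, g X Y p = g X Y q.

Definition pseudo_orthonormal3 (g : operator G -> operator G -> Cinf G)
    (e1 e2 e3 : operator G) : Prop :=
  [/\ g e1 e1 = 1, g e2 e2 = 1 & g e3 e3 = -1] /\
  [/\ g e1 e2 = 0, g e1 e3 = 0 & g e2 e3 = 0] /\
  [/\ g e2 e1 = 0, g e3 e1 = 0 & g e3 e2 = 0].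

End LeftInvariant.

(* Main.v *)
Require Import Defs.
From HB Require Import structures.
From mathcomp Require Import all_boot all_order all_algebra ring lra.
From mathcomp Require Import all_classical all_reals all_analysis.

Set Implicit Arguments.
Unset Strict Implicit.
Unset Printing Implicit Defensive.

Import Order.TTheory GRing.Theory Num.Theory.
Import numFieldNormedType.Exports.

Local Open Scope classical_set_scope.
Local Open Scope ring_scope.

(** The left-invariant frame e1, e2, e3 turns the statement into polynomial
    algebra in the structure constants.  On combinations of the frame with
    constant coefficients all scalar products are constant, so the Koszul
    formula ([koszul]) determines the Levi-Civita connection, and with it the
    Kobayashi-Nomizu connection ([nablak_comb]); its only nonzero values are

      nabla_1 e3 = - gamma e3,  nabla_2 e1 = - gamma e2,  nabla_2 e2 = gamma e1,
      nabla_3 e1 = beta e2,     nabla_3 e2 = - alpha e1.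

    Hence ([curvature_comb], [sym_ricci_comb]) the symmetrized Ricci tensor
    omega has the values omega_11 = - (gamma^2 + beta^2),
    omega_22 = - (gamma^2 + alpha beta), omega_23 = - alpha gamma / 2, the other
    ones being 0 up to symmetry.  The Codazzi equation at (e1, e3; e2) reads
    gamma^2 (alpha / 2 - beta) = 0 and the one at (e1, e3; e3) reads
    alpha beta gamma = 0; as gamma is nonzero, alpha = 2 beta and then
    beta^2 = 0.  Conversely, when alpha = beta = 0, omega is - gamma^2 times the
    metric of the plane (e1, e2), extended by 0 along e3; nabla_2 rotates
    this plane infinitesimally, nabla_1 only rescales e3 and nabla_3
    vanishes, so omega is parallel along the frame, hence Codazzi there.

    Two facts link the frame to arbitrary vector fields.  First, a vector
    field W must be recovered from the functions g(W, e_i)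
    ([frame_expansion]): this identifies nabla_X Y once its scalar products
    with the frame are known, and it expands arbitrary fields.  The key is that
    a left-invariant field which kills all smooth functions at one point is 0
    ([left_invariant_eq0]), because the left translate of a smooth function
    is smooth; so the e_i are independent as functionals at every point, and
    Cramer's rule with well-chosen global functions ([frame_cramer]) gives
    D W = sum_i d_i e_i with D nonzero at any prescribed point.  Pairing
    this with g yields the coordinates of W pointwise.  Second, the Codazzi
    expression is linear over the smooth functions in its three arguments
    ([sym_ricci_tensor02], [cov_deriv02_multilinear]), so that it vanishes
    as soon as it does on the frame ([codazzi_frame]). *)

(** * Maps of class C^k *)
Section DiffClass.
Context {R : realType}.

(** The derivatives in [diff_class] are those of the total map, so being of
    class C^k can be checked on arbitrary, possibly non-open, pieces. *)
Lemma diff_class_local (V W : normedModType R) k (U : set V) (f : V -> W) :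
  (forall x, U x -> exists2 U', U' x & diff_class k U' f) -> diff_class k U f.
Proof.
elim: k f => [|k IH] f /= loc.
  by move=> x /loc[U' U'x cf]; exact: cf.
split=> [x /loc[U' U'x [df _]]|v]; first exact: df.
by apply: IH => x /loc[U' U'x [_ Df]]; exists U'.
Qed.

Lemma diff_class_linear (V W W' : normedModType R) (l : {linear W -> W'}) k
    (U : set V) (f : V -> W) : continuous l -> open U ->
  diff_class k U f -> diff_class k U (l \o f).
Proof.
move=> cl oU; elim: k f => [|k IH] f /=.
  by move=> cf x Ux; apply: continuous_comp; [exact: cf|exact: cl].
move=> [df Df].
have dl y : differentiable l y by exact: linear_differentiable.
split=> [x Ux|v]; first by apply: differentiable_comp; [exact: df|exact: dl].
apply: (diff_class_eq (f := l \o (fun x => 'D_v f x))) (IH _ (Df v)) => // x Ux.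
rewrite [RHS]deriveE; last by apply: differentiable_comp; [exact: df|exact: dl].
rewrite diff_comp ?diff_lin//=; last exact: df.
by rewrite deriveE//; exact: df.
Qed.

Lemma diff_class_coord (V : normedModType R) n k (U : set V)
    (f : V -> 'rV[R]_n) (i : 'I_n) : open U ->
  diff_class k U f -> diff_class k U (fun x => f x 0 i).
Proof.
have cl : continuous (fun w : 'rV[R]_n => w 0 i) by exact: coord_continuous.
have ll : linear (fun w : 'rV[R]_n => w 0 i : R) by move=> a u v; rewrite !mxE.
pose c := GRing.isLinear.Build _ _ _ _ _ ll.
pose l : {linear 'rV[R]_n -> R} := HB.pack (fun w : 'rV[R]_n => w 0 i) c.
exact: (@diff_class_linear _ _ _ l).
Qed.

Lemma diff_class_slice (V1 V2 W : normedModType R) (z : V1) k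
    (U : set (V1 * V2)) (F : V1 * V2 -> W) :
  diff_class k U F -> diff_class k [set x | U (z, x)] (fun x => F (z, x)).
Proof.
elim: k F => [|k IH] F /=.
  move=> cF x Ux; apply: (@continuous_comp _ _ _ (fun x => (z, x))).
    by apply: cvg_pair; [exact: cst_continuous|exact: cvg_id].
  exact: cF.
move=> [dF DF]; split=> [x Ux|v].
  apply: (@differentiable_comp _ _ _ _ (fun x => (z, x))); last exact: dF.
  apply: differentiable_pair; [exact: differentiable_cst|exact: ex_diff].
rewrite (_ : (fun x => _) = fun x => 'D_((0 : V1), v) F (z, x)).
  exact: (IH _ (DF (0, v))).
apply/funext => x; rewrite /derive.
have E h : h *: ((0 : V1), v) + (z, x) = (z, h *: v + x).
  by congr pair; rewrite /= scaler0 add0r.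
by under [in RHS]eq_fun => h do rewrite /= E.
Qed.

Lemma derive_rVE n (W : normedModType R) (f : 'rV[R]_n -> W) x w :
  differentiable f x ->
  'D_w f x = \sum_i w 0 i *: 'D_(delta_mx 0 i) f x.
Proof.
move=> df; rewrite deriveE// [w in LHS]row_sum_delta linear_sum/=.
by apply: eq_bigr => i _; rewrite linearZ /= deriveE.
Qed.

(** By the chain rule in coordinates, each derivative of [f \o phi] is a sum of
    products of a coordinate of a derivative of [phi] with a partial derivative
    of [f] composed with [phi]; the induction on [k] applies to the latter. *)
Lemma diff_class_comp (V : normedModType R) n k (U : set V)
    (U' : set 'rV[R]_n) (phi : V -> 'rV[R]_n) (f : 'rV[R]_n -> R) :
  open U -> (forall x, U x -> U' (phi x)) ->
  diff_class k U phi -> diff_class k U' f -> diff_class k U (f \o phi).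
Proof.
move=> oU UU'; elim: k phi UU' f => [|k IH] phi UU' f.
  move=> cphi cf x Ux; apply: continuous_comp; first exact: cphi.
  by apply: cf; exact: UU'.
move=> Cphi [df Df]; have [dphi Dphi] := Cphi; split=> [x Ux|v].
  by apply: differentiable_comp; [exact: dphi|apply: df; exact: UU'].
apply: (diff_class_eq (f := \sum_i ((fun x => 'D_v phi x 0 i) *
  ((fun y => 'D_(delta_mx 0 i) f y) \o phi)))) => //.
  move=> x Ux.
  have dfx : differentiable f (phi x) by apply: df; exact: UU'.
  have dpx : differentiable phi x by exact: dphi.
  rewrite [RHS]deriveE; last exact: differentiable_comp.
  rewrite diff_comp//= -!deriveE// derive_rVE//.
  by rewrite fct_sumE; apply: eq_bigr => i _.
apply: big_ind => [|g h|i _]; first exact: diff_class_cst.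
  exact: diff_classD.
apply: diff_classM => //.
  by apply: (diff_class_coord (f := fun x => 'D_v phi x)) => //; exact: Dphi.
by apply: IH => //; [exact: diff_classS Cphi|exact: Df].
Qed.

(** Expanding [a] in the standard basis reduces the product to products of
    scalar functions. *)
Lemma diff_classZ (V : normedModType R) n k (U : set V) (f : V -> R)
    (a : V -> 'rV[R]_n) : open U ->
  diff_class k U f -> diff_class k U a -> diff_class k U (fun x => f x *: a x).
Proof.
move=> oU sf sa.
have ll i : linear (fun t : R => t *: delta_mx 0 i : 'rV[R]_n).
  by move=> t u v; rewrite scalerDl scalerA.
pose l i : {linear R -> 'rV[R]_n} := HB.pack
  (fun t : R => t *: delta_mx 0 i : 'rV[R]_n)
  (GRing.isLinear.Build _ _ _ _ _ (ll i)).
rewrite (_ : (fun x => _) = \sum_i (l i \o (f * (fun x => a x 0 i)))).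
  apply: big_ind => [|g h|i _]; first exact: diff_class_cst.
    exact: diff_classD.
  apply: diff_class_linear => //; first exact: scalel_continuous.
  by apply: diff_classM => //; exact: diff_class_coord.
apply/funext => x; rewrite fct_sumE [a x in LHS]row_sum_delta scaler_sumr.
by apply: eq_bigr => i _; rewrite scalerA.
Qed.

End DiffClass.

(** * Smooth functions and their left translates *)
Section SmoothFunctionValues.
Context {R : realType} {n : nat} {M : manifoldType R n}.
Implicit Types f h : Cinf M.

Lemma Cinf_smooth f : smooth_funs f.
Proof. by have := valP f; rewrite inE. Qed.

Lemma Cinf_eq f h : (forall p, f p = h p) -> f = h.
Proof. by move=> fh; apply/val_inj/funext. Qed.

Lemma CinfD f h p : (f + h) p = f p + h p. Proof. by []. Qed.
Lemma CinfN f p : (- f) p = - f p. Proof. by []. Qed.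
Lemma CinfM f h p : (f * h) p = f p * h p. Proof. by []. Qed.
Lemma CinfZ a f p : (a *: f) p = a * f p. Proof. by []. Qed.
Lemma Cinf0 p : (0 : Cinf M) p = 0. Proof. by []. Qed.
Lemma Cinf1 p : (1 : Cinf M) p = 1. Proof. by []. Qed.

Definition Cinf_cst (a : R) : Cinf M := a *: (1 : Cinf M).

Lemma Cinf_cstE a p : Cinf_cst a p = a.
Proof. by rewrite CinfZ Cinf1 mulr1. Qed.

Lemma Cinf_sum (I : finType) (F : I -> Cinf M) p :
  (\sum_i F i) p = \sum_i F i p.
Proof.
by apply: (big_morph (fun f : Cinf M => f p)) => [f h|]; rewrite ?CinfD ?Cinf0.
Qed.

Lemma differentiable_chart f c x : atlas M c -> chart_cod c x ->
  differentiable (fun y => f (chart_inv c y)) x.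
Proof. by move=> ac cx; have [df _] := Cinf_smooth f ac 1; exact: df. Qed.

End SmoothFunctionValues.

Definition Cinf_eval (R : realType) n (M : manifoldType R n) (p : M)
  (f : Cinf M) : R := f p.

Section Evaluation.
Context (R : realType) (n : nat) (M : manifoldType R n) (p : M).

Fact Cinf_eval_zmod : zmod_morphism (Cinf_eval p). Proof. by []. Qed.
Fact Cinf_eval_monoid : monoid_morphism (Cinf_eval p). Proof. by split. Qed.

HB.instance Definition _ :=
  GRing.isZmodMorphism.Build (Cinf M) R (Cinf_eval p) Cinf_eval_zmod.
HB.instance Definition _ :=
  GRing.isMonoidMorphism.Build (Cinf M) R (Cinf_eval p) Cinf_eval_monoid.

End Evaluation.

Lemma continuous_pair_cst (S T U : topologicalType) (a : S) (h : T -> U) y :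
  {for y, continuous h} -> {for y, continuous (fun x => (a, h x))}.
Proof.
by move=> ch; apply: cvg_pair; [exact: cvg_cst|exact: ch].
Qed.

Section Translation.
Context {R : realType} {n : nat} {G : lieGroupType R n}.

(** Near a given point, the function read in a chart [c] is [f] read in a chart
    [e], composed with the slice at the fixed first factor [a] of the
    multiplication map read in charts. *)
Lemma smooth_funs_translation (a : G) (f : Cinf G) :
  smooth_funs (fun p => f (a * p)%g).
Proof.
move=> c ac k; apply: diff_class_local => x cx.
have [e ae ex] := atlas_cover (a * chart_inv c x)%g.
have [c0 ac0 c0a] := atlas_cover a.
pose U := [set y | chart_cod c y /\ chart_dom e (a * chart_inv c y)%g].
exists U => //.
have oU : open U.
  rewrite openE => y [cy ey]; rewrite /interior; apply: filterI.
    by apply: open_nbhs_nbhs; split=> //; exact: chart_open_cod.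
  have cont : {for y, continuous (fun y => (a * chart_inv c y)%g)}.
    apply: (@continuous_comp _ _ _ (fun y => (a, chart_inv c y))
      (fun q : G * G => (q.1 * q.2)%g)); last exact: lie_mul_continuous.
    by apply: continuous_pair_cst; exact: chart_inv_continuous.
  by apply: cont; apply: open_nbhs_nbhs; split=> //; exact: chart_open_dom.
pose phi y := chart_map e (a * chart_inv c y)%g.
apply: (diff_class_eq (f := (fun y => f (chart_inv e y)) \o phi)) => //.
  by move=> y [cy ey]; rewrite /phi /= chart_mapK.
apply: (@diff_class_comp _ _ _ _ _ (chart_cod e)) => //.
- by move=> y [cy ey]; exact: chart_mapS.
- have := diff_class_slice (chart_map c0 a)
    (@lie_mul_smooth _ _ _ _ _ _ ac0 ac ae k).
  rewrite /= chart_mapK// => sphi.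
  apply: diff_class_local => y [cy ey]; eexists; last exact: sphi.
  by split=> //; exact: chart_mapS.
- exact: Cinf_smooth.
Qed.

Definition translation (a : G) (f : Cinf G) : Cinf G :=
  MkCinf (mem_set (smooth_funs_translation a f)).

(** Left-invariance transports the vanishing at [p] to [q], by translation by
    [q * p^-1]: every smooth function at [q] comes from one at [p]. *)
Lemma left_invariant_eq0 (X : operator G) p :
  left_invariant X -> (forall f, X f p = 0) -> X = 0.
Proof.
move=> [_ LX] X0; apply/funext => f; apply: Cinf_eq => q.
have := LX (q * p^-1)%g f (translation (q * p^-1)%g f) (fun=> erefl) p.
by rewrite X0 -mulgA mulVg mulg1.
Qed.

End Translation.

(** * Vector fields as derivations *)
Section VectorFields.
Context {R : realType} {n : nat} {M : manifoldType R n}.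
Implicit Types (f h : Cinf M) (X Y Z : operator M).

Lemma vector_field_at X p c : vector_field X -> atlas M c -> chart_dom c p ->
  exists a, forall f,
    X f p = 'D_a (fun y => f (chart_inv c y)) (chart_map c p).
Proof.
move=> vX ac cp; have [a _ aX] := vX c ac.
exists (a (chart_map c p)) => f.
by rewrite -aX ?chart_mapK//; exact: chart_mapS.
Qed.

Lemma vector_fieldD_fun X f h : vector_field X -> X (f + h) = X f + X h.
Proof.
move=> vX; apply: Cinf_eq => p.
have [c ac cp] := atlas_cover p; have [a aX] := vector_field_at vX ac cp.
rewrite CinfD !aX -deriveD //;
  by apply: diff_derivable; apply: differentiable_chart => //;
    exact: chart_mapS.
Qed.

Lemma vector_fieldM_fun X f h : vector_field X -> X (f * h) = f * X h + h * X f.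
Proof.
move=> vX; apply: Cinf_eq => p.
have [c ac cp] := atlas_cover p; have [a aX] := vector_field_at vX ac cp.
have df (k : Cinf M) :
    derivable (fun y => k (chart_inv c y)) (chart_map c p) a.
  by apply: diff_derivable; apply: differentiable_chart => //;
    exact: chart_mapS.
by have := deriveM (df f) (df h); rewrite CinfD !CinfM !aX chart_mapK.
Qed.

Lemma vector_field_cst X (a : R) : vector_field X -> X (Cinf_cst a) = 0.
Proof.
move=> vX; apply: Cinf_eq => p.
have [c ac cp] := atlas_cover p; have [v aX] := vector_field_at vX ac cp.
rewrite aX (_ : (fun y => _) = cst a) ?derive_cst //.
by apply/funext => y; rewrite Cinf_cstE.
Qed.

Lemma vector_fieldZ_fun X (a : R) f : vector_field X -> X (a *: f) = a *: X f.
Proof.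
move=> vX; have cM (h : Cinf M) : a *: h = Cinf_cst a * h.
  by apply: Cinf_eq => p; rewrite CinfM Cinf_cstE.
by rewrite !cM vector_fieldM_fun// vector_field_cst// mulr0 addr0.
Qed.

Lemma vector_field_fscaleD f X Y :
  vector_field X -> vector_field Y -> vector_field (fscale f X + Y).
Proof.
move=> vX vY c ac; have [a sa aX] := vX c ac; have [b sb bY] := vY c ac.
exists (fun x => f (chart_inv c x) *: a x + b x).
  move=> k; apply: diff_classD (sb k); first exact: chart_open_cod.
  apply: diff_classZ (sa k); first exact: chart_open_cod.
  exact: Cinf_smooth.
move=> h x cx; have dh := differentiable_chart h ac cx.
rewrite [LHS]/(f _ * X h _ + Y h _) aX// bY// !deriveE//.
by rewrite linearD linearZ.
Qed.

Lemma vector_field0 : vector_field (0 : operator M).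
Proof.
move=> c ac; exists (cst 0) => [k|f x cx]; first exact: diff_class_cst.
by rewrite deriveE ?linear0//; exact: differentiable_chart.
Qed.

Lemma scale_fscale (a : R) X : a *: X = fscale (Cinf_cst a) X.
Proof.
by apply/funext => h; apply: Cinf_eq => p; rewrite CinfM Cinf_cstE.
Qed.

Lemma fscale1 X : fscale 1 X = X.
Proof. by apply/funext => h; rewrite /fscale mul1r. Qed.

Lemma vector_field_fscale f X : vector_field X -> vector_field (fscale f X).
Proof.
by move=> vX; rewrite -[fscale _ _]addr0; apply: vector_field_fscaleD => //;
  exact: vector_field0.
Qed.

Lemma vector_fieldD X Y :
  vector_field X -> vector_field Y -> vector_field (X + Y).
Proof. by move=> vX vY; rewrite -[X]fscale1; exact: vector_field_fscaleD. Qed.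

Lemma vector_fieldZ (a : R) X : vector_field X -> vector_field (a *: X).
Proof. by move=> vX; rewrite scale_fscale; exact: vector_field_fscale. Qed.

Lemma vector_fieldN X : vector_field X -> vector_field (- X).
Proof. by move=> vX; rewrite -scaleN1r; exact: vector_fieldZ. Qed.

Lemma vector_fieldB X Y :
  vector_field X -> vector_field Y -> vector_field (X - Y).
Proof. by move=> vX vY; apply: vector_fieldD => //; exact: vector_fieldN. Qed.

Lemma vector_field_sum (I : finType) (X : I -> operator M) :
  (forall i, vector_field (X i)) -> vector_field (\sum_i X i).
Proof.
move=> vX; apply: big_ind => //; first exact: vector_field0.
exact: vector_fieldD.
Qed.

Lemma operator_sum (I : finType) (X : I -> operator M) f p :
  (\sum_i X i) f p = \sum_i X i f p.
Proof. by rewrite fct_sumE Cinf_sum. Qed.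

End VectorFields.

(** * Connections and tensor fields *)
Section TensorCalculus.
Context {R : realType} {n : nat} {M : manifoldType R n}.
Implicit Types (f h : Cinf M) (X Y Z : operator M) (a : R).

Lemma operatorD X Y h : (X + Y) h = X h + Y h. Proof. by []. Qed.
Lemma operatorN X h : (- X) h = - X h. Proof. by []. Qed.
Lemma operatorZ a X h : (a *: X) h = a *: X h. Proof. by []. Qed.
Lemma operator0 h : (0 : operator M) h = 0. Proof. by []. Qed.
Lemma fscaleE f X h : fscale f X h = f * X h. Proof. by []. Qed.
Lemma lie_bracketE X Y h : lie_bracket X Y h = X (Y h) - Y (X h).
Proof. by []. Qed.

Definition pointwiseE := (operatorD, operatorN, operatorZ, operator0, fscaleE,
  @CinfD R n M, @CinfN R n M, @CinfM R n M, @CinfZ R n M, @Cinf0 R n M,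
  @Cinf1 R n M, @Cinf_cstE R n M).

Lemma operator_eq X Y : (forall h p, X h p = Y h p) -> X = Y.
Proof. by move=> XY; apply/funext => h; apply: Cinf_eq. Qed.

Lemma lie_bracket_fscaleD f X Y Z : vector_field Z ->
  lie_bracket (fscale f X + Y) Z =
  fscale f (lie_bracket X Z) + (fscale (- Z f) X + lie_bracket Y Z).
Proof.
move=> vZ; apply: operator_eq => h p.
rewrite !(lie_bracketE, pointwiseE) vector_fieldD_fun// vector_fieldM_fun//.
by rewrite !pointwiseE; ring.
Qed.

Section Tensor02.
Variable w : operator M -> operator M -> Cinf M.
Hypothesis tw : tensor02 w.

Lemma tensor02_0l Z : vector_field Z -> w 0 Z = 0.
Proof.
move=> vZ; have [+ _] := tw 1 vector_field0 vector_field0 vZ.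
by rewrite fscale1 addr0 mul1r -{1}[w 0 Z]addr0 => /addrI.
Qed.

Lemma tensor02_Dl f X Y Z :
  vector_field X -> vector_field Y -> vector_field Z ->
  w (fscale f X + Y) Z = f * w X Z + w Y Z.
Proof. by move=> vX vY vZ; have [] := tw f vX vY vZ. Qed.

Lemma tensor02_Dr f X Y Z :
  vector_field X -> vector_field Y -> vector_field Z ->
  w Z (fscale f X + Y) = f * w Z X + w Z Y.
Proof. by move=> vX vY vZ; have [] := tw f vX vY vZ. Qed.

End Tensor02.

(** (1,2) tensor fields: the difference of two linear connections is one. *)
Definition tensor12 (T : operator M -> operator M -> operator M) : Prop :=
  (forall X Y, vector_field X -> vector_field Y -> vector_field (T X Y)) /\
  forall f X Y Z, vector_field X -> vector_field Y -> vector_field Z ->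
    T (fscale f X + Y) Z = fscale f (T X Z) + T Y Z /\
    T Z (fscale f X + Y) = fscale f (T Z X) + T Z Y.

Lemma linear_connectionB (nab T : operator M -> operator M -> operator M) a :
  linear_connection nab -> tensor12 T ->
  linear_connection (fun X Y => nab X Y - a *: T X Y).
Proof.
move=> [nV nl nD nL] [TV Tl].
have T0 Z : vector_field Z -> T Z 0 = 0.
  move=> vZ; have [_ +] := Tl 1 _ _ _ vector_field0 vector_field0 vZ.
  by rewrite fscale1 addr0 fscale1 -{1}[T Z 0]addr0 => /addrI.
split.
- move=> X Y vX vY; apply: vector_fieldB; first exact: nV.
  by apply: vector_fieldZ; exact: TV.
- move=> f X Y Z vX vY vZ; rewrite nl//; have [-> _] := Tl f _ _ _ vX vY vZ.
  by apply: operator_eq => h p; rewrite !pointwiseE; ring.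
- move=> X Y Z vX vY vZ; rewrite nD//; have [_] := Tl 1 _ _ _ vY vZ vX.
  rewrite !fscale1 => ->.
  by apply: operator_eq => h p; rewrite !pointwiseE; ring.
- move=> f X Y vX vY; rewrite nL//; have [_] := Tl f _ _ _ vY vector_field0 vX.
  rewrite T0// !addr0 => ->.
  by apply: operator_eq => h p; rewrite !pointwiseE; ring.
Qed.

Section Connection.
Variable nab : operator M -> operator M -> operator M.
Hypothesis cnab : linear_connection nab.

Lemma connectionV X Y :
  vector_field X -> vector_field Y -> vector_field (nab X Y).
Proof. by have [+ _ _ _] := cnab; exact. Qed.

Lemma connection_Dl f X Y Z :
  vector_field X -> vector_field Y -> vector_field Z ->
  nab (fscale f X + Y) Z = fscale f (nab X Z) + nab Y Z.
Proof. by have [_ + _ _] := cnab; exact. Qed.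

Lemma connection_Dr f X Y Z :
  vector_field X -> vector_field Y -> vector_field Z ->
  nab Z (fscale f X + Y) = fscale (Z f) X + (fscale f (nab Z X) + nab Z Y).
Proof.
move=> vX vY vZ; have [_ _ nD nL] := cnab.
by rewrite nD ?nL ?addrA//; exact: vector_field_fscale.
Qed.

(** The derivative terms of the Leibniz rule appear in [nab Z (J (fscale f X))]
    and in [J (nab Z (fscale f X))] alike, and cancel. *)
Lemma cov_deriv11_tensor12 (J : operator M -> operator M) :
  tensor11 J -> tensor12 (cov_deriv11 nab J).
Proof.
move=> [JV Jl]; split.
  move=> X Y vX vY; apply: vector_fieldB; first exact: connectionV (JV _ vY).
  by apply: JV; exact: connectionV.
have J2 f f' X Y Z : vector_field X -> vector_field Y -> vector_field Z ->
    J (fscale f X + (fscale f' Y + Z)) =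
    fscale f (J X) + (fscale f' (J Y) + J Z).
  by move=> *; rewrite !Jl//; exact: vector_field_fscaleD.
move=> f X Y Z vX vY vZ; split; rewrite /cov_deriv11.
  rewrite !connection_Dl ?Jl//;
    [|exact: connectionV|exact: connectionV|exact: JV].
  by apply: operator_eq => h p; rewrite !pointwiseE; ring.
rewrite Jl// !connection_Dr ?J2//; try exact: JV; try exact: connectionV.
by apply: operator_eq => h p; rewrite !pointwiseE; ring.
Qed.

(** A torsion-free connection provides the closure under brackets assumed
    here: the bracket is then a difference of covariant derivatives. *)
Section Curvature.
Hypothesis bV : forall X Y, vector_field X -> vector_field Y ->
  vector_field (lie_bracket X Y).

Lemma curvatureV X Y Z : vector_field X -> vector_field Y -> vector_field Z ->
  vector_field (curvature nab X Y Z).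
Proof.
move=> vX vY vZ; apply: vector_fieldB.
  by apply: vector_fieldB; do 2?apply: connectionV.
by apply: connectionV => //; exact: bV.
Qed.

(** The term [- (W f) X] of the bracket cancels the derivative of [f] along [W]
    in the iterated covariant derivative. *)
Lemma curvature_Dl f X Y Z W :
  vector_field X -> vector_field Y -> vector_field Z -> vector_field W ->
  curvature nab (fscale f X + Y) W Z =
  fscale f (curvature nab X W Z) + curvature nab Y W Z.
Proof.
move=> vX vY vZ vW; have nV := connectionV.
rewrite /curvature lie_bracket_fscaleD//.
rewrite [nab (_ + (_ + _)) _]connection_Dl//; [|exact: bV|].
  rewrite [nab (_ + lie_bracket _ _) _]connection_Dl//; last exact: bV.
  rewrite ![nab (_ + Y) _]connection_Dl//; last exact: nV.
  rewrite connection_Dr//; [|exact: nV|exact: nV].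
  by apply: operator_eq => h p; rewrite !pointwiseE; ring.
by apply: vector_field_fscaleD => //; exact: bV.
Qed.

(** The second derivatives of [f] combine into [X (Y f) - Y (X f)], which the
    bracket term removes. *)
Lemma curvature_Dr f X Y Z W :
  vector_field X -> vector_field Y -> vector_field Z -> vector_field W ->
  curvature nab X Y (fscale f Z + W) =
  fscale f (curvature nab X Y Z) + curvature nab X Y W.
Proof.
move=> vX vY vZ vW; have nV := connectionV; have vB := bV vX vY.
rewrite /curvature !(connection_Dr _ vZ vW)//.
have nDr3 f1 f2 V1 V2 V3 V : vector_field V1 -> vector_field V2 ->
    vector_field V3 -> vector_field V ->
    nab V (fscale f1 V1 + (fscale f2 V2 + V3)) =
    fscale (V f1) V1 + (fscale f1 (nab V V1) +
      (fscale (V f2) V2 + (fscale f2 (nab V V2) + nab V V3))).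
  by move=> *; rewrite !connection_Dr//; exact: vector_field_fscaleD.
rewrite !nDr3//; try exact: nV.
by apply: operator_eq => h p; rewrite !(lie_bracketE, pointwiseE); ring.
Qed.

Lemma ricci_tensor02 g e1 e2 e3 : tensor02 g ->
  vector_field e1 -> vector_field e2 -> vector_field e3 ->
  tensor02 (ricci g nab e1 e2 e3).
Proof.
move=> tg v1 v2 v3 f X Y Z vX vY vZ; have cV := curvatureV.
split; rewrite /ricci.
  rewrite !curvature_Dl// !(tensor02_Dl tg); try exact: cV; try by [].
  by apply: Cinf_eq => p; rewrite !pointwiseE; ring.
rewrite !curvature_Dr// !(tensor02_Dl tg); try exact: cV; try by [].
by apply: Cinf_eq => p; rewrite !pointwiseE; ring.
Qed.

Lemma sym_ricci_tensor02 g e1 e2 e3 : tensor02 g ->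
  vector_field e1 -> vector_field e2 -> vector_field e3 ->
  tensor02 (sym_ricci g nab e1 e2 e3).
Proof.
move=> tg v1 v2 v3 f X Y Z vX vY vZ.
have tr := ricci_tensor02 tg v1 v2 v3.
split; rewrite /sym_ricci !(tensor02_Dl tr)// !(tensor02_Dr tr)//;
  by apply: Cinf_eq => p; rewrite !pointwiseE; ring.
Qed.

End Curvature.

Lemma cov_deriv02_multilinear (w : operator M -> operator M -> Cinf M)
    f X Y Z W :
  tensor02 w -> vector_field X -> vector_field Y -> vector_field Z ->
  vector_field W ->
  [/\ cov_deriv02 nab w (fscale f X + W) Y Z =
       f * cov_deriv02 nab w X Y Z + cov_deriv02 nab w W Y Z,
      cov_deriv02 nab w X (fscale f Y + W) Z =
       f * cov_deriv02 nab w X Y Z + cov_deriv02 nab w X W Z &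
      cov_deriv02 nab w X Y (fscale f Z + W) =
       f * cov_deriv02 nab w X Y Z + cov_deriv02 nab w X Y W].
Proof.
move=> tw vX vY vZ vW; have nV := connectionV.
have w3l f1 f2 V1 V2 V3 V : vector_field V1 -> vector_field V2 ->
    vector_field V3 -> vector_field V ->
    w (fscale f1 V1 + (fscale f2 V2 + V3)) V =
    f1 * w V1 V + (f2 * w V2 V + w V3 V).
  by move=> *; rewrite !(tensor02_Dl tw)//; exact: vector_field_fscaleD.
have w3r f1 f2 V1 V2 V3 V : vector_field V1 -> vector_field V2 ->
    vector_field V3 -> vector_field V ->
    w V (fscale f1 V1 + (fscale f2 V2 + V3)) =
    f1 * w V V1 + (f2 * w V V2 + w V V3).
  by move=> *; rewrite !(tensor02_Dr tw)//; exact: vector_field_fscaleD.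
split; rewrite /cov_deriv02.
- rewrite !connection_Dl// (tensor02_Dl tw) ?(tensor02_Dr tw)//; try exact: nV.
  by apply: Cinf_eq => p; rewrite !pointwiseE; ring.
- rewrite connection_Dr// !(tensor02_Dl tw)// ?w3l//;
    try solve [exact: nV | by apply: vector_field_fscaleD => //; exact: nV].
  rewrite (vector_fieldD_fun _ _ vX) (vector_fieldM_fun _ _ vX).
  by apply: Cinf_eq => p; rewrite !pointwiseE; ring.
- rewrite connection_Dr// !(tensor02_Dr tw)// ?w3r//;
    try solve [exact: nV | by apply: vector_field_fscaleD => //; exact: nV].
  rewrite (vector_fieldD_fun _ _ vX) (vector_fieldM_fun _ _ vX).
  by apply: Cinf_eq => p; rewrite !pointwiseE; ring.
Qed.

End Connection.

(** Both corrections subtracted from the Levi-Civita connection are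
    tensorial, since they are built from the covariant derivative of [J]. *)
Lemma kobayashi_nomizu_connection
    (nab : operator M -> operator M -> operator M) J : linear_connection nab ->
  product_structure J -> linear_connection (kobayashi_nomizu nab J).
Proof.
move=> cnab [tJ JJ]; have [tV tl] := cov_deriv11_tensor12 cnab tJ.
have [JV Jl] := tJ.
apply: linear_connectionB; first apply: linear_connectionB => //.
  split=> [X Y vX vY|f X Y Z vX vY vZ]; first by apply: tV => //; exact: JV.
  split; first by apply: (tl _ _ _ _ vX vY (JV _ vZ)).1.
  by rewrite Jl//; apply: (tl _ _ _ _ (JV _ vX) (JV _ vY) vZ).2.
split=> [X Y vX vY|f X Y Z vX vY vZ].
  by apply: vector_fieldB; apply: tV => //; exact: JV.
have JVX := JV _ vX; have JVY := JV _ vY; have JVZ := JV _ vZ.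
rewrite !Jl//; split.
  rewrite (tl _ _ _ _ JVX JVY vZ).2 (tl _ _ _ _ vX vY JVZ).2.
  by apply: operator_eq => h p; rewrite !pointwiseE; ring.
rewrite (tl _ _ _ _ vX vY JVZ).1 (tl _ _ _ _ JVX JVY vZ).1.
by apply: operator_eq => h p; rewrite !pointwiseE; ring.
Qed.

(** The usual Koszul formula loses its three derivative terms when the mutual
    scalar products of the fields are constant, as for left-invariant fields. *)
Lemma koszul (g : operator M -> operator M -> Cinf M) nab X Y Z :
  levi_civita g nab ->
  (forall X Y, vector_field X -> vector_field Y -> g X Y = g Y X) ->
  tensor02 g -> vector_field X -> vector_field Y -> vector_field Z ->
  X (g Y Z) = 0 -> Y (g Z X) = 0 -> Z (g X Y) = 0 ->
  2 *: g (nab X Y) Z = g (lie_bracket X Y) Z - g (lie_bracket Y Z) X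
                       + g (lie_bracket Z X) Y.
Proof.
move=> [cnab tor met] gC tg vX vY vZ XYZ YZX ZXY.
have nV V W := connectionV cnab (X := V) (Y := W).
have gB U V W : vector_field U -> vector_field V -> vector_field W ->
    g (U - V) W = g U W - g V W.
  move=> vU vV vW; rewrite addrC -scaleN1r scale_fscale (tensor02_Dl tg)//.
  by apply: Cinf_eq => p; rewrite !pointwiseE; ring.
rewrite -!tor// !gB//; try exact: nV.
have := met X Y Z vX vY vZ; have := met Y Z X vY vZ vX.
have := met Z X Y vZ vX vY; rewrite /cov_deriv02 XYZ YZX ZXY.
rewrite (gC X)//; last exact: nV.
rewrite (gC Y)//; last exact: nV.
rewrite (gC Z)//; last exact: nV.
move=> /(congr1 (fun f : Cinf M => f _)) + /(congr1 (fun f : Cinf M => f _)) +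
  /(congr1 (fun f : Cinf M => f _)) + => E1 E2 E3.
apply: Cinf_eq => p; move: (E1 p) (E2 p) (E3 p).
rewrite !pointwiseE; lra.
Qed.

End TensorCalculus.

(** * Left-invariant frames *)
Section Frame.
Context {R : realType} {n : nat} {G : lieGroupType R n}.
Variable e : 'I_n -> operator G.
Hypothesis eL : forall i, left_invariant (e i).
Hypothesis eI : forall c : 'rV[R]_n, \sum_i c 0 i *: e i = 0 -> c = 0.

Let eV i : vector_field (e i). Proof. by have [] := eL i. Qed.

Lemma frame_independent_at p (c : 'rV[R]_n) :
  (forall f, \sum_i c 0 i * e i f p = 0) -> c = 0.
Proof.
move=> c0; apply: eI; apply: (left_invariant_eq0 (p := p)) => [|f].
  split; first by apply: vector_field_sum => i; exact: vector_fieldZ.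
  move=> a f h fh q; rewrite !operator_sum; apply: eq_bigr => i _.
  by have [_ Li] := eL i; rewrite !CinfZ (Li a f h fh).
by rewrite operator_sum -[RHS](c0 f).
Qed.

(** In a chart at [p], a vector field is a derivative along a vector of the
    model space; the vectors of the [e i] form a basis there, since a linear
    relation between them is a relation between the [e i] at [p]. *)
Lemma frame_span_at p (W : operator G) : vector_field W ->
  exists k : 'I_n -> R, forall f, W f p = \sum_i k i * e i f p.
Proof.
move=> vW; have [c ac cp] := atlas_cover p.
have df (f : Cinf G) :
    differentiable (fun y => f (chart_inv c y)) (chart_map c p).
  by apply: differentiable_chart => //; exact: chart_mapS.
have [w wE] := vector_field_at vW ac cp.
have [a aE] := fin_all_exists (fun i => vector_field_at (eV i) ac cp).
pose A : 'M[R]_n := \matrix_i a i.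
have uA : A \in unitmx.
  rewrite -row_free_unit -kermx_eq0; apply/eqP/row_matrixP => i; rewrite row0.
  apply: (frame_independent_at (p := p)) => f.
  have /(congr1 (row i)) := mulmx_ker A; rewrite row0 row_mul => kA.
  have := df f; set F := fun y => _ => dF.
  rewrite (_ : \sum_j _ = 'D_(row i (kermx A) *m A) F (chart_map c p)).
    by rewrite kA deriveE // linear0.
  rewrite deriveE// mulmx_sum_row linear_sum; apply: eq_bigr => j _.
  by rewrite linearZ/= aE rowK deriveE.
exists (fun i => (w *m invmx A) 0 i) => f.
rewrite wE deriveE// -[w in LHS](mulmxKV uA) mulmx_sum_row linear_sum.
apply: eq_bigr => i _.
by rewrite linearZ/= aE rowK deriveE.
Qed.

(** The vectors [(e i f p)_i], for [f] ranging over the smooth functions, span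
    the whole space because their annihilator is 0; so [n] of them form a
    basis. *)
Lemma frame_separated_at p :
  exists F : 'I_n -> Cinf G, \det (\matrix_(j, i) e i (F j) p) != 0.
Proof.
pose A m (F : 'I_m -> Cinf G) : 'M[R]_(m, n) := \matrix_(j, i) e i (F j) p.
have [m [F rF]] : exists m (F : 'I_m -> Cinf G), (n <= \rank (A m F))%N.
  suff H r : (r <= n)%N ->
      exists m (F : 'I_m -> Cinf G), (r <= \rank (A m F))%N.
    exact: H (leqnn n).
  elim: r => [|r IH] rn; first by exists 0%N, (fun=> 0).
(* As long as the rank is not full, some column [c] is killed by all rows
     chosen so far; a function detecting [c] raises the rank. *)
  have [m [F rF]] := IH (ltnW rn).
  have [rF'|] := boolP (r < \rank (A m F))%N; first by exists m, F.
  rewrite -leqNgt => Fr.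
  have : cokermx (A m F) != 0.
    by rewrite -mxrank_eq0 mxrank_coker subn_eq0 -ltnNge (leq_ltn_trans Fr).
  case/matrix0Pn => i0 [j0 cij].
  pose c := (col j0 (cokermx (A m F)))^T.
  have [f cf] : exists f, \sum_i c 0 i * e i f p != 0.
    apply: contrapT => /forallNP c0; move/eqP: cij; apply.
    have /(_ _)/rowP/(_ i0) := @frame_independent_at p c.
    by rewrite !mxE; apply=> f; apply/eqP/negP => /negP /c0.
  pose F' (j : 'I_(1 + m)) := if fintype.split j is inr k then F k else f.
  exists (1 + m)%N, F'; rewrite ltnNge; apply/negP => F'r.
  have FF' : (A m F <= A _ F')%MS.
    apply/row_subP => k; rewrite (_ : row k _ = row (rshift 1 k) (A _ F')).
      exact: row_sub.
    by apply/rowP => i; rewrite !mxE /F' (unsplitK (inr k)).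
  have : (A _ F' <= A m F)%MS.
    by rewrite -(geq_leqif (mxrank_leqif_sup FF')) (leq_trans F'r).
  move/row_subP/(_ (lshift m 0)); rewrite submxE => /eqP/rowP/(_ j0).
  rewrite [RHS]mxE mxE => s0; move/eqP: cf; apply; rewrite -[RHS]s0.
  apply: eq_bigr => i _.
  by rewrite !mxE /F' (unsplitK (inl 0)) mulrC.
have fF : row_full (A m F) by rewrite /row_full eqn_leq rank_leq_col.
exists (fun j => F (fullrankfun fF j)).
have := fullrowsub_unit fF; rewrite unitmxE unitfE; congr (\det _ != 0).
by apply/matrixP => i j; rewrite !mxE.
Qed.

(** Cramer's rule for the coordinates of [W], with the denominator kept on the
    left: the determinant and the adjugate of the matrix [e i (F j)] are
    polynomials in smooth functions, hence smooth without any division. *)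
Lemma frame_cramer (p : G) (W : operator G) : vector_field W ->
  exists (D : Cinf G) (d : 'I_n -> Cinf G), D p != 0 /\
    fscale D W = \sum_i fscale (d i) (e i).
Proof.
move=> vW; have [F detF] := frame_separated_at p.
pose A : 'M[Cinf G]_n := \matrix_(j, i) e i (F j).
pose w : 'cV[Cinf G]_n := \col_j W (F j).
have evA q : map_mx (Cinf_eval q) A = \matrix_(j, i) e i (F j) q.
  by apply/matrixP => i j; rewrite !mxE.
have evdet q : \det A q = \det (map_mx (Cinf_eval q) A).
  by rewrite (det_map_mx (Cinf_eval q)).
exists (\det A), (fun i => (\adj A *m w) i 0).
split; first by rewrite evdet evA.
apply/funext => f; apply: Cinf_eq => q; rewrite operator_sum CinfM.
have [k kE] := frame_span_at q vW.
have wk : map_mx (Cinf_eval q) w = map_mx (Cinf_eval q) A *m \col_i k i.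
  apply/colP => j; rewrite !mxE [LHS]kE; apply: eq_bigr => i _.
  by rewrite !mxE mulrC.
rewrite kE mulr_sumr; apply: eq_bigr => i _; rewrite mulrA CinfM; congr (_ * _).
have /colP/(_ i) :
    map_mx (Cinf_eval q) (\adj A *m w) = (\det A q) *: \col_i k i.
  by rewrite map_mxM map_mx_adj wk mulmxA mul_adj_mx mul_scalar_mx evdet.
by rewrite !mxE => <-.
Qed.

(** Pairing the relation of [frame_cramer] with [e j] identifies the Cramer
    numerators as [D * eps j * g W (e j)]; at the point where [D] is nonzero
    it cancels. *)
Lemma frame_expansion (g : operator G -> operator G -> Cinf G)
    (eps : 'I_n -> R) (W : operator G) :
  tensor02 g ->
  (forall i j, g (e i) (e j) = if i == j then Cinf_cst (eps i) else 0) ->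
  (forall i, eps i * eps i = 1) -> vector_field W ->
  W = \sum_i fscale (eps i *: g W (e i)) (e i).
Proof.
move=> gT ge eps2 vW.
have v0 : vector_field (0 : operator G) := vector_field0.
have gsum (d : 'I_n -> Cinf G) j : g (\sum_i fscale (d i) (e i)) (e j) =
    eps j *: d j.
  transitivity (\sum_i d i * g (e i) (e j)).
    pose K X h := vector_field X /\ g X (e j) = h.
    suff: K (\sum_i fscale (d i) (e i)) (\sum_i d i * g (e i) (e j)) by case.
    apply: (big_ind2 K) => [|X h Y k [vX <-] [vY <-]|i _].
    - by split=> //; exact: (tensor02_0l gT).
    - split; first exact: vector_fieldD.
      by rewrite -[X in g (X + _)]fscale1 (tensor02_Dl gT)// mul1r.
    - split; first exact: vector_field_fscale.
      by rewrite -[fscale _ _]addr0 (tensor02_Dl gT)// (tensor02_0l gT)// addr0.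
  rewrite (bigD1 j)//= ge eqxx big1 ?addr0 => [|i /negbTE ij]; last first.
    by rewrite ge ij mulr0.
  by apply: Cinf_eq => p; rewrite CinfM Cinf_cstE CinfZ mulrC.
apply/funext => f; apply: Cinf_eq => p; rewrite operator_sum.
have [D [d [Dp DW]]] := frame_cramer p vW.
have dE j : d j = D * (eps j *: g W (e j)).
  have /(congr1 (fun X => eps j *: g X (e j))) := DW.
  rewrite gsum scalerA eps2 scale1r => <-.
  rewrite -[fscale D W]addr0 (tensor02_Dl gT)//.
  by rewrite (tensor02_0l gT)// addr0; apply: Cinf_eq => q;
    rewrite !(CinfM, CinfZ) mulrCA.
apply: (mulfI Dp); rewrite -CinfM -[D * W f]/(fscale D W f) DW operator_sum.
rewrite mulr_sumr; apply: eq_bigr => i _.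
by rewrite [LHS]CinfM dE CinfM -mulrA.
Qed.

End Frame.

(** * Pseudo-orthonormal frames in dimension three *)
Section FrameDim3.
Context {R : realType} {G : lieGroupType R 3}.
Context (e1 e2 e3 : operator G) (g : operator G -> operator G -> Cinf G).
Hypothesis basis : lie_algebra_basis3 e1 e2 e3.
Hypothesis gT : tensor02 g.
Hypothesis gE : pseudo_orthonormal3 g e1 e2 e3.

Let e (i : 'I_3) : operator G := [:: e1; e2; e3]`_i.
Let eps (i : 'I_3) : R := [:: 1; 1; -1]`_i.

Let eL i : left_invariant (e i).
Proof. by case: basis => l1 l2 l3 _; case: i => [[|[|[|//]]] ?]. Qed.

Lemma basis_vector_field :
  [/\ vector_field e1, vector_field e2 & vector_field e3].
Proof. by case: basis => [[v1 _] [v2 _] [v3 _] _]. Qed.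

Let eI (c : 'rV[R]_3) : \sum_i c 0 i *: e i = 0 -> c = 0.
Proof.
case: basis => _ _ _ /(_ 0) [|x [_ xU]].
  by split=> //; exact: vector_field0.
rewrite !big_ord_recl big_ord0 addr0 addrA => c0.
have x0 := xU (0, 0, 0); rewrite /= !scale0r !addr0 in x0.
have /esym := xU (c 0 0, c 0 (lift ord0 ord0), c 0 (lift ord0 (lift ord0 ord0)))
  (esym c0).
rewrite x0// => -[c1 c2 c3].
apply/rowP => -[[|[|[|//]]] i3]; rewrite mxE.
- by rewrite -[RHS]c1; congr (c _ _); exact: val_inj.
- by rewrite -[RHS]c2; congr (c _ _); exact: val_inj.
- by rewrite -[RHS]c3; congr (c _ _); exact: val_inj.
Qed.

Lemma frame_expansion3 W : vector_field W ->
  W = fscale (g W e1) e1 + (fscale (g W e2) e2 + fscale (- g W e3) e3).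
Proof.
move=> vW; rewrite [LHS](frame_expansion eL eI (g := g) (eps := eps))//.
- by rewrite !big_ord_recl big_ord0 addr0 /e /eps /= !scale1r scaleN1r.
- have [[g11 g22 g33] [[g12 g13 g23] [g21 g31 g32]]] := gE.
  have c1 : Cinf_cst 1 = 1 :> Cinf G by rewrite /Cinf_cst scale1r.
  have cN1 : Cinf_cst (-1) = -1 :> Cinf G by rewrite /Cinf_cst scaleN1r.
  by move=> [[|[|[|//]]] ?] [[|[|[|//]]] ?]; rewrite /e /eps /= ?c1 ?cN1.
- by move=> [[|[|[|//]]] ?]; rewrite /eps /= ?mulr1 ?mulrNN ?mulr1.
Qed.

Lemma frame_ind (P : operator G -> Prop) :
  (forall f X Y, vector_field X -> vector_field Y -> P X -> P Y ->
    P (fscale f X + Y)) ->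
  P e1 -> P e2 -> P e3 -> forall X, vector_field X -> P X.
Proof.
move=> PD P1 P2 P3 X vX; have [v1 v2 v3] := basis_vector_field.
have v0 : vector_field (0 : operator G) := vector_field0.
have P0 : P 0.
  rewrite (_ : 0 = fscale (-1) e1 + e1); first exact: PD.
  by apply: operator_eq => h p; rewrite !pointwiseE; ring.
rewrite (frame_expansion3 vX) -[X in _ + (_ + X)]addr0.
apply: (PD) => //; first by do 2!apply: vector_field_fscaleD => //.
apply: (PD) => //; first by apply: vector_field_fscaleD.
exact: PD.
Qed.

Lemma codazzi_frame (nab : operator G -> operator G -> operator G) w :
  linear_connection nab -> tensor02 w ->
  (forall X Y Z, [set e1; e2; e3] X -> [set e1; e2; e3] Y ->
    [set e1; e2; e3] Z ->
    cov_deriv02 nab w X Y Z - cov_deriv02 nab w Y X Z = 0) ->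
  codazzi nab w.
Proof.
move=> cnab tw w0; pose F : set (operator G) := [set e1; e2; e3].
have [v1 v2 v3] := basis_vector_field.
have F1 : F e1 by left; left.
have F2 : F e2 by left; right.
have F3 : F e3 by right.
have FV X : F X -> vector_field X by case=> [[->|->]|->].
pose T X Y Z := cov_deriv02 nab w X Y Z - cov_deriv02 nab w Y X Z.
have lin f (t t' u u' : Cinf G) : t - u = 0 -> t' - u' = 0 ->
    f * t + t' - (f * u + u') = 0.
  by move=> /subr0_eq-> /subr0_eq->; rewrite subrr.
have cl := cov_deriv02_multilinear cnab.
have T3 X Y : F X -> F Y -> forall Z, vector_field Z -> T X Y Z = 0.
  move=> FX FY; have vX := FV _ FX; have vY := FV _ FY.
  apply: frame_ind; [|exact: w0..] => f Z W vZ vW TZ TW.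
  have [_ _ E1] := cl _ f _ _ _ _ tw vX vY vZ vW.
  have [_ _ E2] := cl _ f _ _ _ _ tw vY vX vZ vW.
  by rewrite /T E1 E2; exact: lin.
have T2 X : F X -> forall Y, vector_field Y ->
    forall Z, vector_field Z -> T X Y Z = 0.
  move=> FX; have vX := FV _ FX.
  apply: frame_ind; [|exact: T3..] => f Y W vY vW TY TW Z vZ.
  have [_ E1 _] := cl _ f _ _ _ _ tw vX vY vZ vW.
  have [E2 _ _] := cl _ f _ _ _ _ tw vY vX vZ vW.
  by rewrite /T E1 E2; apply: lin; [exact: TY|exact: TW].
move=> X Y Z vX vY vZ; move: X vX Y vY Z vZ.
apply: frame_ind; [|exact: T2..] => f X W vX vW TX TW Y vY Z vZ.
have [E1 _ _] := cl _ f _ _ _ _ tw vX vY vZ vW.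
have [_ E2 _] := cl _ f _ _ _ _ tw vY vX vZ vW.
by rewrite E1 E2; apply: lin; [exact: TX|exact: TW].
Qed.

End FrameDim3.

(** * The Lie algebra of the group and its Kobayashi-Nomizu connection *)
Section G2.
Context {R : realType} {G : lieGroupType R 3}.
Context (alpha beta gamma : R) (e1 e2 e3 : operator G).
Context (g : operator G -> operator G -> Cinf G).
Context (J : operator G -> operator G).
Context (nablaL : operator G -> operator G -> operator G).
Hypothesis basis : lie_algebra_basis3 e1 e2 e3.
Hypothesis br12 : lie_bracket e1 e2 = gamma *: e2 - beta *: e3.
Hypothesis br13 : lie_bracket e1 e3 = - (beta *: e2) - gamma *: e3.
Hypothesis br23 : lie_bracket e2 e3 = alpha *: e1.
Hypothesis gT : tensor02 g.
Hypothesis gC : forall X Y, vector_field X -> vector_field Y -> g X Y = g Y X.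
Hypothesis gE : pseudo_orthonormal3 g e1 e2 e3.
Hypothesis JP : product_structure J.
Hypotheses (J1 : J e1 = e1) (J2 : J e2 = e2) (J3 : J e3 = - e3).
Hypothesis LC : levi_civita g nablaL.

Let nablak := kobayashi_nomizu nablaL J.

(** Constants enter through [fscale], so that linearity over the smooth
    functions applies to these combinations as it stands. *)
Definition comb (x y z : R) : operator G :=
  fscale (Cinf_cst x) e1 + (fscale (Cinf_cst y) e2 + fscale (Cinf_cst z) e3).

Let v1 : vector_field e1. Proof. by have [] := basis_vector_field basis. Qed.
Let v2 : vector_field e2. Proof. by have [] := basis_vector_field basis. Qed.
Let v3 : vector_field e3. Proof. by have [] := basis_vector_field basis. Qed.

Lemma combV x y z : vector_field (comb x y z).
Proof.
by do 2!apply: vector_field_fscaleD => //; exact: vector_field_fscale.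
Qed.

Lemma combE x y z h p :
  comb x y z h p = x * e1 h p + y * e2 h p + z * e3 h p.
Proof. by rewrite !pointwiseE addrA. Qed.

Lemma comb_congr x y z x' y' z' :
  x = x' -> y = y' -> z = z' -> comb x y z = comb x' y' z'.
Proof. by move=> -> -> ->. Qed.

Lemma comb_e1 : e1 = comb 1 0 0.
Proof. by apply: operator_eq => h p; rewrite combE; ring. Qed.
Lemma comb_e2 : e2 = comb 0 1 0.
Proof. by apply: operator_eq => h p; rewrite combE; ring. Qed.
Lemma comb_e3 : e3 = comb 0 0 1.
Proof. by apply: operator_eq => h p; rewrite combE; ring. Qed.

Lemma combB x y z x' y' z' :
  comb x y z - comb x' y' z' = comb (x - x') (y - y') (z - z').
Proof.
apply: operator_eq => h p.
by rewrite operatorD operatorN CinfD CinfN !combE; ring.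
Qed.

Lemma combZ a x y z : a *: comb x y z = comb (a * x) (a * y) (a * z).
Proof.
by apply: operator_eq => h p; rewrite operatorZ CinfZ !combE; ring.
Qed.

Lemma tensor02_comb w x y z Z : tensor02 w -> vector_field Z ->
  w (comb x y z) Z = x *: w e1 Z + (y *: w e2 Z + z *: w e3 Z).
Proof.
move=> tw vZ; have v0 : vector_field (0 : operator G) := vector_field0.
have c3 := vector_field_fscaleD (Cinf_cst z) v3 v0.
have c23 := vector_field_fscaleD (Cinf_cst y) v2 c3.
rewrite /comb -[fscale _ e3]addr0 !(tensor02_Dl tw)// (tensor02_0l tw)//.
by apply: Cinf_eq => p; rewrite !pointwiseE; ring.
Qed.

Lemma g_comb x y z x' y' z' :
  g (comb x y z) (comb x' y' z') = Cinf_cst (x * x' + y * y' - z * z').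
Proof.
have [[g11 g22 g33] [[g12 g13 g23] [g21 g31 g32]]] := gE.
rewrite (tensor02_comb _ _ _ gT (combV _ _ _)).
rewrite !(gC _ (combV _ _ _))// !(tensor02_comb _ _ _ gT)//.
rewrite g11 g22 g33 g12 g13 g23 g21 g31 g32.
by apply: Cinf_eq => p; rewrite !pointwiseE; ring.
Qed.

Lemma J_comb x y z : J (comb x y z) = comb x y (- z).
Proof.
have [[JV Jl] _] := JP.
have v0 : vector_field (0 : operator G) := vector_field0.
have J0 : J 0 = 0.
  have := Jl 1 _ _ v0 v0; rewrite !fscale1 addr0 -{1}[J 0]addr0.
  by move/addrI.
have c3 := vector_field_fscaleD (Cinf_cst z) v3 v0.
have c23 := vector_field_fscaleD (Cinf_cst y) v2 c3.
rewrite /comb -[fscale (Cinf_cst z) e3]addr0 !Jl//.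
by rewrite J1 J2 J3 J0; apply: operator_eq => h p; rewrite !pointwiseE; ring.
Qed.

Lemma lie_bracket_comb x y z x' y' z' :
  lie_bracket (comb x y z) (comb x' y' z') =
  comb (alpha * (y * z' - z * y'))
       (gamma * (x * y' - y * x') - beta * (x * z' - z * x'))
       (- beta * (x * y' - y * x') - gamma * (x * z' - z * x')).
Proof.
apply: operator_eq => h p.
have E12 := congr1 (fun X : operator G => X h p) br12.
have E13 := congr1 (fun X : operator G => X h p) br13.
have E23 := congr1 (fun X : operator G => X h p) br23.
rewrite !(lie_bracketE, pointwiseE) in E12 E13 E23.
move/(canRL (subrK _)) in E12; move/(canRL (subrK _)) in E13.
move/(canRL (subrK _)) in E23.
have combh a b c : comb a b c h = a *: e1 h + (b *: e2 h + c *: e3 h).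
  by apply: Cinf_eq => q; rewrite combE !pointwiseE addrA.
rewrite lie_bracketE CinfD CinfN !combE !combh.
have D1 f k := vector_fieldD_fun f k v1.
have D2 f k := vector_fieldD_fun f k v2.
have D3 f k := vector_fieldD_fun f k v3.
have Z1 a f := vector_fieldZ_fun a f v1.
have Z2 a f := vector_fieldZ_fun a f v2.
have Z3 a f := vector_fieldZ_fun a f v3.
rewrite !(D1, D2, D3) !(Z1, Z2, Z3).
by rewrite !pointwiseE E12 E13 E23; ring.
Qed.

(** The sign in the third hypothesis comes from [e3] being timelike. *)
Lemma vector_field_comb W x y z : vector_field W ->
  g W e1 = Cinf_cst x -> g W e2 = Cinf_cst y -> g W e3 = Cinf_cst (- z) ->
  W = comb x y z.
Proof.
move=> vW W1 W2 W3; rewrite (frame_expansion3 basis gT gE vW) W1 W2 W3.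
by apply: operator_eq => h p; rewrite !pointwiseE; ring.
Qed.

Lemma nablaL_comb x y z x' y' z' :
  nablaL (comb x y z) (comb x' y' z') =
  comb (gamma * (y * y' + z * z') + alpha / 2 * (y * z' - z * y'))
       ((alpha / 2 - beta) * x * z' - gamma * y * x' + alpha / 2 * z * x')
       ((alpha / 2 - beta) * x * y' + alpha / 2 * y * x' + gamma * z * x').
Proof.
have cL : linear_connection nablaL by case: LC.
have vx := combV x y z; have vy := combV x' y' z'.
have gL a b c : g (nablaL (comb x y z) (comb x' y' z')) (comb a b c) = Cinf_cst
   ((gamma * (y * y' + z * z') + alpha / 2 * (y * z' - z * y')) * a
  + ((alpha / 2 - beta) * x * z' - gamma * y * x' + alpha / 2 * z * x') * b
  - ((alpha / 2 - beta) * x * y' + alpha / 2 * y * x' + gamma * z * x') * c).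
  have vc := combV a b c.
  have := koszul LC gC gT vx vy vc.
  rewrite !lie_bracket_comb !g_comb (vector_field_cst _ vx).
  rewrite (vector_field_cst _ vy) (vector_field_cst _ vc).
  move=> /(_ erefl erefl erefl) kE; apply: Cinf_eq => p.
  have /(congr1 (fun f : Cinf G => f p)) := kE; rewrite CinfZ => kEp.
  apply: (mulfI (x := 2)); first by rewrite pnatr_eq0.
  by rewrite kEp !pointwiseE; field.
by apply: vector_field_comb; [exact: (connectionV cL)|..];
  rewrite ?[in LHS]comb_e1 ?[in LHS]comb_e2 ?[in LHS]comb_e3 gL;
  congr Cinf_cst; ring.
Qed.

Lemma nablak_comb x y z x' y' z' :
  nablak (comb x y z) (comb x' y' z') =
  comb (gamma * y * y' - alpha * z * y')
       (beta * z * x' - gamma * y * x')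
       (- gamma * x * z').
Proof.
rewrite /nablak /kobayashi_nomizu /canonical_connection /cov_deriv11.
do ![rewrite J_comb | rewrite nablaL_comb | rewrite combB | rewrite combZ].
by apply: comb_congr; field.
Qed.

Lemma curvature_comb x y z x' y' z' x'' y'' z'' :
  curvature nablak (comb x y z) (comb x' y' z') (comb x'' y'' z'') =
  comb (- (gamma ^+ 2 + alpha * beta) * (x * y' - y * x') * y''
          + gamma * (beta - alpha) * (x * z' - z * x') * y''
          + gamma * (beta - alpha) * (y * z' - z * y') * x'')
       ((gamma ^+ 2 + beta ^+ 2) * (x * y' - y * x') * x''
          + gamma * (alpha - beta) * (y * z' - z * y') * y'')
       (alpha * gamma * (y * z' - z * y') * z'').
Proof.
rewrite /curvature lie_bracket_comb !nablak_comb !combB.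
by apply: comb_congr; ring.
Qed.

Lemma sym_ricci_comb x y z x' y' z' :
  sym_ricci g nablak e1 e2 e3 (comb x y z) (comb x' y' z') =
  Cinf_cst (- (gamma ^+ 2 + beta ^+ 2) * x * x'
            - (gamma ^+ 2 + alpha * beta) * y * y'
            - alpha * gamma / 2 * (y * z' + z * y')).
Proof.
rewrite /sym_ricci /ricci comb_e1 comb_e2 comb_e3 !curvature_comb !g_comb.
by apply: Cinf_eq => p; rewrite !pointwiseE; field.
Qed.

Let omega := sym_ricci g nablak e1 e2 e3.

Lemma cov_deriv_sym_ricci_comb x y z x' y' z' x'' y'' z'' :
  cov_deriv02 nablak omega (comb x y z) (comb x' y' z') (comb x'' y'' z'') =
  omega (comb (- gamma * y * y' + alpha * z * y')
              (gamma * y * x' - beta * z * x') (gamma * x * z'))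
        (comb x'' y'' z'') +
  omega (comb x' y' z')
        (comb (- gamma * y * y'' + alpha * z * y'')
              (gamma * y * x'' - beta * z * x'') (gamma * x * z'')).
Proof.
rewrite /cov_deriv02 !nablak_comb /omega !sym_ricci_comb.
rewrite (vector_field_cst _ (combV x y z)).
by apply: Cinf_eq => p; rewrite !pointwiseE; ring.
Qed.

End G2.

Theorem theorem4p8 (R : realType) (G : lieGroupType R 3)
    (alpha beta gamma : R) (e1 e2 e3 : operator G)
    (g : operator G -> operator G -> Cinf G)
    (J : operator G -> operator G)
    (nablaL : operator G -> operator G -> operator G) :
  gamma != 0 ->
  connected [set: G] ->
  simply_connected R G ->
  lie_algebra_basis3 e1 e2 e3 ->
  lie_bracket e1 e2 = gamma *: e2 - beta *: e3 ->
  lie_bracket e1 e3 = - (beta *: e2) - gamma *: e3 ->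
  lie_bracket e2 e3 = alpha *: e1 ->
  lorentzian_metric g ->
  left_invariant_metric g ->
  pseudo_orthonormal3 g e1 e2 e3 ->
  product_structure J ->
  J e1 = e1 -> J e2 = e2 -> J e3 = - e3 ->
  levi_civita g nablaL ->
  let nablak := kobayashi_nomizu nablaL J in
  codazzi nablak (sym_ricci g nablak e1 e2 e3) <->
  gamma != 0 /\ alpha = 0 /\ beta = 0.
Proof.
move=> gamma0 _ _ basis br12 br13 br23 [gT gC _] _ gE JP J1 J2 J3 LC nablak.
have [v1 v2 v3] := basis_vector_field basis.
have [cL tor _] := LC.
have sE := sym_ricci_comb basis br12 br13 br23 gT gC gE JP J1 J2 J3 LC.
have dE :=
  cov_deriv_sym_ricci_comb basis br12 br13 br23 gT gC gE JP J1 J2 J3 LC.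
have e1E := comb_e1 e1 e2 e3; have e2E := comb_e2 e1 e2 e3.
have e3E := comb_e3 e1 e2 e3.
split=> [cod|[_ [alpha0 beta0]]].
(* Only the pair (e1, e3) matters: evaluated on e2, then on e3, it gives
     alpha = 2 beta and alpha beta = 0. *)
  have V := combV basis.
  have /(congr1 (Cinf_eval 1%g)) := cod _ _ _ (V 1 0 0) (V 0 0 1) (V 0 1 0).
  rewrite !dE !sE /Cinf_eval !pointwiseE => cod132.
  have /(congr1 (Cinf_eval 1%g)) := cod _ _ _ (V 1 0 0) (V 0 0 1) (V 0 0 1).
  rewrite !dE !sE /Cinf_eval !pointwiseE => cod133.
  have ab : alpha = 2 * beta.
    apply: (mulfI (expf_neq0 2 gamma0)); lra.
  have : beta ^+ 2 * gamma = 0 by rewrite ab in cod133; lra.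
  move/eqP; rewrite mulf_eq0 (negbTE gamma0) orbF expf_eq0 => /eqP b0.
  by rewrite ab b0 mulr0.
apply: (codazzi_frame basis gT gE).
- exact: kobayashi_nomizu_connection.
- apply: sym_ricci_tensor02 => //; first exact: kobayashi_nomizu_connection.
  move=> X Y vX vY; rewrite -tor//.
  by apply: vector_fieldB; exact: (connectionV cL).
(* The Codazzi difference vanishes on all constant combinations at once. *)
have frameE X : [set e1; e2; e3] X -> exists x y z, X = comb e1 e2 e3 x y z.
  case=> [[->|->]|->].
  - by exists 1, 0, 0; exact: e1E.
  - by exists 0, 1, 0; exact: e2E.
  - by exists 0, 0, 1; exact: e3E.
move=> X Y Z /frameE[x [y [z ->]]] /frameE[x' [y' [z' ->]]].
move=> /frameE[x'' [y'' [z'' ->]]].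
rewrite !dE !sE alpha0 beta0.
by apply: Cinf_eq => p; rewrite !pointwiseE; ring.
Qed.
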